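(* For all $n\ge 1$ and $k\ge 0$, if the polynomial $A_{n,k}(q)$ is nonzero then it is symmetric.
   Context: For a permutation $\sigma=b_1\ldots b_n$, $\mathrm{des}\,\sigma=\#\{i:b_i>b_{i+1}\}$ and $\mathrm{maj}\,\sigma=\sum_{b_i>b_{i+1}}i$. $\mathrm{Av}_n(321)$ is the set of permutations of $[n]$ with no $i<j<k$ such that $b_i>b_j>b_k$. Let $A_{n,k}(q)=\sum q^{\mathrm{maj}\,\sigma}$, the sum over all $\sigma\in\mathrm{Av}_n(321)$ with $\mathrm{des}\,\sigma=k$ (i.e. the coefficient of $t^k$ in $\sum_{\sigma\in\mathrm{Av}_n(321)}q^{\mathrm{maj}\,\sigma}t^{\mathrm{des}\,\sigma}$). A nonzero polynomial $f(x)=\sum_{i=r}^s a_ix^i$ with $a_r\neq0$, $a_s\neq0$ is symmetric if $a_i=a_j$ whenever $i+j=r+s$. *)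

(* Defs.v *)
From mathcomp Require Import all_boot all_fingroup all_algebra.

Set Implicit Arguments.
Unset Strict Implicit.
Unset Printing Implicit Defensive.

Import GRing.Theory.
Local Open Scope ring_scope.

(* Permutations of [n] are elements of 'S_n acting on positions and values
   0, ..., n - 1: the one-line word b_1 ... b_n has b_(i.+1) = (s i).+1. *)

Definition avoids321 (n : nat) (s : 'S_n) : bool :=
  [forall i : 'I_n, forall j : 'I_n, forall k : 'I_n,
     ~~ [&& (i < j)%N, (j < k)%N, (s j < s i)%N & (s k < s j)%N]].

Definition Av321 (n : nat) : {set 'S_n} := [set s | avoids321 s].

Definition descents (n : nat) (s : 'S_n) : {set 'I_n} :=
  [set i : 'I_n | [exists j : 'I_n, (j == i.+1 :> nat) && (s j < s i)%N]].

Definition des (n : nat) (s : 'S_n) : nat := #|descents s|.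

(* The 0-based position i is the 1-based position i.+1. *)
Definition maj (n : nat) (s : 'S_n) : nat := (\sum_(i in descents s) i.+1)%N.

Definition A321 (n k : nat) : {poly int} :=
  \sum_(s in Av321 n | des s == k) 'X^(maj s).

(* The two nonvanishing conditions force f != 0 and determine r <= t. *)
Definition symmetric_poly (R : nzRingType) (f : {poly R}) : Prop :=
  exists r t : nat,
    [/\ f = \sum_(r <= i < t.+1) f`_i *: 'X^i,
        f`_r != 0,
        f`_t != 0
      & forall i j : nat, (i + j = r + t)%N -> f`_i = f`_j].

(* Main.v *)
Require Import Defs.
From mathcomp Require Import all_boot all_fingroup all_algebra.
From mathcomp Require Import zify.

(** The reverse-complement of a permutation of [n] preserves 321-avoidance and
    sends a descent at (1-based) position i to one at position n - i.  Hence it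
    permutes the 321-avoiders with k descents and replaces maj by k n - maj, so
    the coefficients of q^i and q^(k n - i) in A_{n,k} agree. *)

Import GRing.Theory.
Local Open Scope ring_scope.

(** With [t] the degree, reflection carries the leading coefficient to index [m - t] and every index
    below that past the degree, so [m - t] is the lowest exponent. *)
Lemma symmetric_poly_of_reflection (R : nzRingType) (f : {poly R}) (m : nat) :
    f != 0 -> (forall i, (m < i)%N -> f`_i = 0) ->
    (forall i j, (i + j = m)%N -> f`_i = f`_j) ->
  symmetric_poly f.
Proof.
move=> f0 hgt hsym.
have [t st] : {t | size f = t.+1}.
  by exists (size f).-1; rewrite prednK // size_poly_gt0.
have hbig i : (t < i)%N -> f`_i = 0 by move=> ti; rewrite nth_default // st.
have ft : f`_t != 0 by rewrite -[t]/(t.+1.-1) -st -lead_coefE lead_coef_eq0.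
(* [hgt] is what makes [m - t] a genuine subtraction: [hsym] says nothing about indices above
   [m]. *)
have tm : (t <= m)%N by rewrite leqNgt; apply: contraNN ft => /hgt ->.
have fr : f`_(m - t) != 0 by rewrite (hsym _ t) ?subnK.
have rt : (m - t <= t.+1)%N.
  by rewrite leqW // leqNgt; apply: contraNN fr => /hbig ->.
exists (m - t)%N, t; rewrite subnK //; split=> //.
rewrite -[LHS]coefK poly_def st -(big_mkord predT (fun i => f`_i *: 'X^i)) /=.
rewrite (big_cat_nat (leq0n _) rt) /= big_nat big1 ?add0r // => i /andP[_ hi].
rewrite (hsym i (m - i)%N); last by lia.
by rewrite hbig ?scale0r //; lia.
Qed.

Section ReverseComplement.

Local Set Implicit Arguments.
Local Unset Strict Implicit.

Variable n : nat.
Implicit Types (s : 'S_n) (i : 'I_n).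

Definition revcomp s : 'S_n :=
  (perm (@rev_ord_inj n) * s * perm (@rev_ord_inj n))%g.

Lemma revcompE s i : revcomp s i = rev_ord (s (rev_ord i)).
Proof. by rewrite !permM !permE. Qed.

Lemma revcompK : involutive revcomp.
Proof. by move=> s; apply/permP => i; rewrite !revcompE !rev_ordK. Qed.

(** The pattern 321 is its own reverse-complement: an occurrence at i < j < k comes from one in [s]
    at the reversed positions of k, j, i. *)
Lemma avoids321_revcomp s : avoids321 s -> avoids321 (revcomp s).
Proof.
move=> /forallP hs; apply/forallP => i; apply/forallP => j; apply/forallP => k.
have /forallP/(_ (rev_ord j))/forallP/(_ (rev_ord i)) := hs (rev_ord k).
apply: contraNN; rewrite !revcompE /=.
move: (ltn_ord i) (ltn_ord j) (ltn_ord k).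
move: (ltn_ord (s (rev_ord i))) (ltn_ord (s (rev_ord j))).
move: (ltn_ord (s (rev_ord k))) => *; lia.
Qed.

(* The 1-based map p |-> n - p, extended by fixing p = n (never a descent). *)
Definition descent_reflect i : 'I_n := rev_ord (ordS i).

Lemma descent_reflectE i : (i.+1 < n)%N -> descent_reflect i = (n - i.+2)%N :> nat.
Proof. by move=> hi; rewrite /= modn_small. Qed.

Lemma descent_reflectK : involutive descent_reflect.
Proof.
move=> i; apply: val_inj => /=.
have [hi | hi] := ltnP i.+1 n.
  by rewrite (modn_small hi) modn_small; lia.
(* At the last position [ordS] wraps round to 0, which [rev_ord] sends back to n - 1. *)
have -> : i.+1 = n by have := ltn_ord i; lia.
rewrite modnn subn1 prednK; last by case: n i {hi} => // -[].
by rewrite modnn; have := ltn_ord i; lia.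
Qed.

Lemma descents_lt s i : i \in descents s -> (i.+1 < n)%N.
Proof. by rewrite inE => /existsP[j /andP[/eqP <- _]]. Qed.

Lemma descents_revcompW s i :
  i \in descents s -> descent_reflect i \in descents (revcomp s).
Proof.
move=> hd; have hi := descents_lt hd; move: hd.
rewrite !inE => /existsP[j /andP[/eqP ji lt]].
(* The two positions of the descent swap sides, so [rev_ord i] is now the right-hand one. *)
apply/existsP; exists (rev_ord i); rewrite descent_reflectE //= !revcompE.
apply/andP; split; first by apply/eqP; lia.
have -> : rev_ord (descent_reflect i) = j.
  by apply: val_inj; rewrite rev_ordK /= modn_small.
rewrite rev_ordK /=.
have := ltn_ord (s i); have := ltn_ord (s j); lia.
Qed.

Lemma descents_revcomp s i :
  (descent_reflect i \in descents (revcomp s)) = (i \in descents s).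
Proof.
apply/idP/idP; last exact: descents_revcompW.
by move/descents_revcompW; rewrite descent_reflectK revcompK.
Qed.

Lemma des_revcomp s : des (revcomp s) = des s.
Proof.
rewrite /des -!sum1_card (reindex_inj (inv_inj descent_reflectK)) /=.
by apply: eq_bigl => i; rewrite descents_revcomp.
Qed.

(** Each descent p of [s] pairs with n - p, contributing n in total. The additive form also bounds
    [maj s] by [des s * n]. *)
Lemma maj_revcomp s : (maj (revcomp s) + maj s = des s * n)%N.
Proof.
rewrite /maj (reindex_inj (inv_inj descent_reflectK)) /=.
rewrite (eq_bigl _ _ (descents_revcomp s)) -big_split /= -sum_nat_const.
by apply: eq_bigr => i /descents_lt hi; rewrite modn_small //; lia.
Qed.

End ReverseComplement.

Lemma coef_A321 (n k d : nat) :
  (A321 n k)`_d = \sum_(s in Av321 n | des s == k) (d == maj s)%:R.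
Proof. by rewrite /A321 coef_sum; apply: eq_bigr => s _; rewrite coefXn. Qed.

Theorem theorem7p1 (n k : nat) (hn : (1 <= n)%N) (hA : A321 n k != 0) :
  symmetric_poly (A321 n k).
Proof.
apply: (@symmetric_poly_of_reflection _ _ (k * n)) => // [d hd | d e hde].
  rewrite coef_A321 big1 // => s /andP[_ /eqP hk].
  by have := maj_revcomp s; rewrite hk; case: eqP => //; lia.
(* Reindexing by [revcomp] keeps the summation range and turns exponent [d] into [k * n - d], which
   is [e]. *)
rewrite !coef_A321 (reindex_inj (inv_inj (@revcompK n))) /=.
apply: eq_big => [s | s /andP[_ hk]].
  rewrite des_revcomp !inE; congr (_ && _).
  by apply/idP/idP => /avoids321_revcomp; rewrite ?revcompK.
have := maj_revcomp s; rewrite -(des_revcomp s) (eqP hk) => hm.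
by congr (_%:R); congr nat_of_bool; lia.
Qed.
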